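(* Let $n,m$ be non-negative integers with $n+m\ge 1$. Let $J=\begin{pmatrix}J_1&J_2\\ J_3&J_4\end{pmatrix}$ be a complex matrix of order $n+m$, where $J_1$ is $n\times n$ and $J_4$ is $m\times m$ and nonsingular, and let $L=\begin{pmatrix}D&0\\0&0\end{pmatrix}$ be of order $n+m$, where $D$ is a nonsingular diagonal $n\times n$ matrix. Let $\alpha,\beta,k\in\mathbb{C}$ with $J-\alpha L$ nonsingular, $k\neq 0$ and $\beta\neq-\bar\alpha$. Put $$C_{k,\alpha,\beta}=k(J+\bar\beta L)(J-\alpha L)^{-1},\qquad D_{k,\alpha,\beta}=k(J-\alpha L)^{-1}(J+\bar\beta L).$$ Then: (a) The eigenspace of $C_{k,\alpha,\beta}$ associated with the eigenvalues different from $k$ is the range of $L$. (b) The eigenspace of $D_{k,\alpha,\beta}$ associated with the eigenvalues different from $k$ is the range of $(J-\alpha L)^{-1}L$.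
   Context: For a square complex matrix $B$ and a scalar $k$, ''the eigenspace of $B$ associated with the eigenvalues different from $k$'' means the invariant (spectral) subspace of $B$ corresponding to those eigenvalues, i.e. the direct sum of the generalized eigenspaces $\ker (B-\mu I)^{N}$ ($N$ the order of $B$) over all eigenvalues $\mu\neq k$ of $B$. The range of a matrix is its column space. A bar denotes complex conjugation. *)

(* Defs.v *)
From mathcomp Require Export all_boot all_order all_algebra.
From mathcomp Require Export complex.
From mathcomp Require Export reals.

Set Implicit Arguments.
Unset Strict Implicit.
Unset Printing Implicit Defensive.

Import Order.TTheory GRing.Theory Num.Theory.
Local Open Scope ring_scope.

(* MathComp matrices act on row vectors, and a matrix stands for its row space.
   Here matrices act on columns: a subspace of column vectors is represented by
   a matrix whose row space is the set of the transposes of its elements. *)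

Definition colrange (F : fieldType) (m n : nat) (A : 'M[F]_(m, n)) :
  'M[F]_(n, m) := A^T.

Lemma colrangeP (F : fieldType) (m n : nat) (A : 'M[F]_(m, n))
    (v : 'cV[F]_m) :
  reflect (exists w : 'cV[F]_n, v = A *m w) (v^T <= colrange A)%MS.
Proof.
apply: (iffP submxP) => [[w vE]|[w ->]]; last by exists w^T; rewrite trmx_mul.
by exists w^T; apply: trmx_inj; rewrite vE trmx_mul trmxK.
Qed.

Definition eigenvalues (F : closedFieldType) (N : nat) (B : 'M[F]_N) : seq F :=
  sval (closed_field_poly_normal (char_poly B)).

Lemma eigenvaluesP (F : closedFieldType) (N : nat) (B : 'M[F]_N) (mu : F) :
  reflect (exists2 v : 'cV[F]_N, B *m v = mu *: v & v != 0)
          (mu \in eigenvalues B).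
Proof.
have -> : (mu \in eigenvalues B) = eigenvalue B^T mu.
  have -> : eigenvalue B^T mu = root (char_poly B) mu.
    rewrite eigenvalue_root_char /char_poly -det_tr /char_poly_mx.
    by rewrite linearB /= tr_scalar_mx map_trmx trmxK.
  rewrite /eigenvalues.
  case: closed_field_poly_normal => r /= ->.
  by rewrite rootZ ?root_prod_XsubC // lead_coef_eq0 monic_neq0 ?char_poly_monic.
apply: (iffP eigenvalueP) => [[v Bv v0]|[v Bv v0]]; exists v^T.
- by apply: trmx_inj; rewrite trmx_mul trmxK Bv linearZ /= trmxK.
- by rewrite trmx_eq0.
- by rewrite -trmx_mul Bv linearZ.
- by rewrite trmx_eq0.
Qed.

Definition col_geigenspace (F : fieldType) (N : nat) (B : 'M[F]_N) (mu : F) :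
  'M[F]_N := geigenspace B^T mu.

Lemma col_geigenspaceP (F : fieldType) (N : nat) (B : 'M[F]_N) (mu : F)
    (v : 'cV[F]_N) :
  reflect ((B - mu%:M) ^+ N *m v = 0) (v^T <= col_geigenspace B mu)%MS.
Proof.
case: N B v => [|N] B v.
  by rewrite [v]flatmx0 trmx0 sub0mx mulmx0; constructor.
rewrite /col_geigenspace geigenspaceE sub_kermx.
have -> : B^T - mu%:M = (B - mu%:M)^T by rewrite linearB /= tr_scalar_mx.
have trX p : (B - mu%:M)^T ^+ p = ((B - mu%:M) ^+ p)^T.
  elim: p => [|p IHp]; first by rewrite !expr0 trmx1.
  by rewrite exprS exprSr IHp -!mulmxE trmx_mul.
rewrite trX -trmx_mul trmx_eq0.
exact: eqP.
Qed.

(* The spectral subspace of B for the eigenvalues different from k. *)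
Definition spectral_subspace (F : closedFieldType) (N : nat) (B : 'M[F]_N)
    (k : F) : 'M[F]_N :=
  (\sum_(mu : seq_sub (eigenvalues B) | val mu != k)
     col_geigenspace B (val mu))%MS.

Lemma mxdirect_spectral_subspace (F : closedFieldType) (N : nat) (B : 'M[F]_N)
    (k : F) :
  mxdirect (\sum_(mu : seq_sub (eigenvalues B) | val mu != k)
     col_geigenspace B (val mu))%MS.
Proof. by apply: mxdirect_sum_geigenspace => i j _ _ /val_inj. Qed.

(* Main.v *)
Require Import Defs.

Import Order.TTheory GRing.Theory Num.Theory.
Local Open Scope ring_scope.

(** With S = (J - alpha L)^-1 and c = k (alpha + conj beta), which is nonzero,
    writing J + conj beta L = (J - alpha L) + (alpha + conj beta) L gives

      C - k I = c L S   and   D - k I = c S L.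

    As S is invertible, the ranges of these two matrices are those of L and of
    S L.  For any matrix B, the spectral subspace for the eigenvalues different
    from k lies in the range of B - k I, because B - k I is invertible on it;
    it is the whole range as soon as k is a semisimple eigenvalue of B (or not
    an eigenvalue), that is, when B - k I and its square have the same kernel:
    then B - k I kills the generalized eigenspace of k, which is a complement
    of the spectral subspace.  This is [spectral_subspace_semisimple].

    Semisimplicity follows from the nonsingularity of J4, in the form
    L S L y = 0 -> L y = 0 ([mul_LSL_eq0]).  Indeed z = S L y satisfies L z = 0,
    so J z = (J - alpha L) z = L y.  The upper half of z vanishes since D is
    nonsingular, and the lower half of J z = L y says that J4 sends the lower
    half of z to 0; hence z = 0 and L y = 0. *)

(** A Bezout relation u p + v q = 1, evaluated at g, writes any vector killed
    by p(g) as the image under q(g) of its image under v(g). *)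
Lemma kermxpoly_sub_horner_mx (F : fieldType) (N : nat) (g : 'M[F]_N.+1)
    (p q : {poly F}) :
  coprimep p q -> (kermxpoly g p <= horner_mx g q)%MS.
Proof.
move=> /Bezout_eq1_coprimepP [[u v]] /= /(congr1 (horner_mx g)).
rewrite rmorph1 rmorphD [u * p]mulrC !rmorphM /= => uv1.
rewrite -[kermxpoly g p]mulr1 -uv1 mulrDr -!mulmxE !mulmxA.
by rewrite mulmx_ker mul0mx add0r submxMl.
Qed.

Lemma geigenspace_sub_range (F : fieldType) (N : nat) (g : 'M[F]_N) (a b : F) :
  a != b -> (geigenspace g a <= g - b%:M)%MS.
Proof.
case: N g => [|N] g aNb; first by rewrite thinmx0 sub0mx.
have -> : g - b%:M = horner_mx g ('X - b%:P).
  by rewrite rmorphB /= horner_mx_X horner_mx_C.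
apply: kermxpoly_sub_horner_mx; apply: coprimep_expl.
by rewrite coprimep_XsubC2 // subr_eq0 eq_sym.
Qed.

(** If the kernels of M = g - a I and of its square agree, then by induction so
    do the kernels of all the positive powers of M, in
    particular of the one that defines the generalized eigenspace. *)
Lemma geigenspace_semisimple (F : fieldType) (N : nat) (g : 'M[F]_N) (a : F) :
  (kermx ((g - a%:M) *m (g - a%:M)) <= kermx (g - a%:M))%MS ->
  geigenspace g a *m (g - a%:M) = 0.
Proof.
case: N g => [|N] g ker2; first by rewrite [LHS]thinmx0.
have kerX p : (kermx ((g - a%:M) ^+ p) <= kermx (g - a%:M))%MS.
  elim: p => [|p IHp].
    have /eqP -> : kermx (1 : 'M[F]_N.+1) == 0.
      by rewrite kermx_eq0 row_free_unit unitmx1.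
    exact: sub0mx.
  apply: submx_trans ker2; apply/sub_kermxP; rewrite mulmxA.
  apply/sub_kermxP; apply: submx_trans IHp.
  by rewrite sub_kermx -mulmxA -[_ *m _ ^+ p]/(_ * _) -exprS mulmx_ker.
by apply/sub_kermxP; rewrite geigenspaceE.
Qed.

Lemma dvdp_prod_exp (F : fieldType) (I : eqType) (r : seq I)
    (f : I -> {poly F}) (p : {poly F}) :
  {in r, forall i, f i %| p} -> \prod_(i <- r) f i %| p ^+ size r.
Proof.
elim: r => [|i r IHr] fp; first by rewrite big_nil expr0.
rewrite big_cons exprS dvdp_mul ?fp ?mem_head // IHr // => j rj.
by rewrite fp // in_cons rj orbT.
Qed.

Lemma char_poly_tr (R : comNzRingType) (N : nat) (A : 'M[R]_N) :
  char_poly A^T = char_poly A.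
Proof.
rewrite /char_poly -det_tr /char_poly_mx linearB /= tr_scalar_mx.
by rewrite map_trmx trmxK.
Qed.

(** The N-th power of the product of the X - mu, for mu ranging over the
    distinct eigenvalues, is a multiple of the characteristic polynomial, hence
    annihilates B, and its kernel splits along its pairwise coprime factors. *)
Lemma sum_col_geigenspace (F : closedFieldType) (N : nat) (B : 'M[F]_N) :
  (1%:M <= \sum_(mu : seq_sub (eigenvalues B)) col_geigenspace B (val mu))%MS.
Proof.
case: N B => [|N] B; first by rewrite thinmx0 sub0mx.
pose p (mu : seq_sub (eigenvalues B)) : {poly F} := ('X - (val mu)%:P) ^+ N.+1.
have p_coprime : {in predT &, forall mu nu, nu != mu -> coprimep (p mu) (p nu)}.
  move=> mu nu _ _ nuNmu; apply/coprimep_expl/coprimep_expr.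
  by rewrite coprimep_XsubC2 // subr_eq0 (inj_eq val_inj).
have [charE sz] : char_poly B = \prod_(z <- eigenvalues B) ('X - z%:P) /\
    size (eigenvalues B) = N.+1.
  have charE : char_poly B = \prod_(z <- eigenvalues B) ('X - z%:P).
    rewrite /eigenvalues; case: closed_field_poly_normal => r /= rE.
    by rewrite {1}rE (monicP (char_poly_monic B)) scale1r.
  split=> //; apply/eqP.
  by rewrite -eqSS -(size_prod_XsubC _ id) -charE size_char_poly.
have annih : mxminpoly B^T %| \prod_mu p mu.
  apply: dvdp_trans (mxminpoly_dvd_char _) _.
  rewrite char_poly_tr charE /p prodrXl -[X in _ ^+ X]sz.
  apply: dvdp_prod_exp => z zr.
  by rewrite (bigD1 (SeqSub zr)) //= dvdp_mulr.
by rewrite -(kermxpoly_prod B^T p_coprime) (kermxpoly_min annih).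
Qed.

(** The spectral subspace S is stable under M = B - k I and lies in its range;
    the whole space is the sum of S and of the generalized eigenspace of k,
    which M kills, so that the range of M is the image of S, contained in S. *)
Lemma spectral_subspace_semisimple (F : closedFieldType) (N : nat)
    (B : 'M[F]_N) (k : F) :
  (forall w : 'cV[F]_N,
     (B - k%:M) *m ((B - k%:M) *m w) = 0 -> (B - k%:M) *m w = 0) ->
  (spectral_subspace B k :=: colrange (B - k%:M))%MS.
Proof.
move=> ker2; have -> : colrange (B - k%:M) = B^T - k%:M.
  by rewrite /colrange linearB /= tr_scalar_mx.
have geig0 : col_geigenspace B k *m (B^T - k%:M) = 0.
  apply: geigenspace_semisimple; apply/rV_subP => v.
  have <- : (B - k%:M)^T = B^T - k%:M by rewrite linearB /= tr_scalar_mx.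
  rewrite !sub_kermx -trmx_mul -[v]trmxK -!trmx_mul !trmx_eq0 -mulmxA.
  by move=> /eqP/ker2/eqP.
have stab : (spectral_subspace B k *m (B^T - k%:M) <= spectral_subspace B k)%MS.
  rewrite sumsmxMr; apply: sumsmxS => mu _.
  apply: comm_mx_stable_geigenspace.
  by rewrite /comm_mx mulmxBr mulmxBl scalar_mxC.
apply/eqmxP/andP; split.
  by apply/sumsmx_subP => mu muNk; apply: geigenspace_sub_range.
have full : (1%:M <= col_geigenspace B k + spectral_subspace B k)%MS.
  apply: (submx_trans (sum_col_geigenspace _ _ B)); apply/sumsmx_subP => mu _.
  have [-> | muNk] := eqVneq (val mu) k; first exact: addsmxSl.
  apply: (submx_trans _ (addsmxSr _ _)).
  by rewrite /spectral_subspace (sumsmx_sup mu).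
rewrite -[X in (X <= _)%MS]mul1mx; apply: (submx_trans (submxMr _ full)).
by rewrite addsmxMr geig0 addsmx_sub sub0mx.
Qed.

(** In the terms of K = J - a L, this says that the upper left block of the
    inverse of K is injective, as it should be: it is the inverse of the Schur
    complement of J4 in K.  The vector z = K^-1 L y gives a direct argument. *)
Lemma mul_LSL_eq0 (F : fieldType) (n m : nat)
    (J1 : 'M[F]_n) (J2 : 'M[F]_(n, m)) (J3 : 'M[F]_(m, n)) (J4 : 'M[F]_m)
    (D : 'M[F]_n) (a : F) (p : nat) (y : 'M[F]_(n + m, p)) :
  let J := block_mx J1 J2 J3 J4 in
  let L : 'M[F]_(n + m) := block_mx D 0 0 0 in
  J4 \in unitmx -> D \in unitmx -> J - a *: L \in unitmx ->
  L *m (invmx (J - a *: L) *m (L *m y)) = 0 -> L *m y = 0.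
Proof.
move=> J L uJ4 uD uK; set z := invmx _ *m _ => Lz0.
have Jz : J *m z = L *m y.
  by rewrite -[RHS](mulKVmx uK) mulmxBl -scalemxAl -/z Lz0 scaler0 subr0.
have zu0 : usubmx z = 0.
  move: Lz0; rewrite -[z]vsubmxK mul_block_col !mul0mx !addr0.
  rewrite -(col_mx0 F n m) => /eq_col_mx[/(congr1 (mulmx (invmx D)))].
  by rewrite mulKmx // mulmx0 col_mxKu.
have zd0 : dsubmx z = 0.
  move: Jz; rewrite -[z]vsubmxK -[y]vsubmxK zu0 !mul_block_col !mulmx0 !mul0mx.
  rewrite !add0r addr0 => /eq_col_mx[_ /(congr1 (mulmx (invmx J4)))].
  by rewrite mulKmx // mulmx0 col_mxKd.
by rewrite -Jz -[z]vsubmxK zu0 zd0 col_mx0 mulmx0.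
Qed.

Theorem proposition2p4 (R : realType) (n m : nat)
    (J1 : 'M[R[i]]_n) (J2 : 'M[R[i]]_(n, m))
    (J3 : 'M[R[i]]_(m, n)) (J4 : 'M[R[i]]_m)
    (D : 'M[R[i]]_n) (alpha beta k : R[i]) :
  let J : 'M[R[i]]_(n + m) := block_mx J1 J2 J3 J4 in
  let L : 'M[R[i]]_(n + m) := block_mx D 0 0 0 in
  let C_kab := k *: ((J + beta^* *: L) *m invmx (J - alpha *: L)) in
  let D_kab := k *: (invmx (J - alpha *: L) *m (J + beta^* *: L)) in
  (1 <= n + m)%N ->
  J4 \in unitmx ->
  is_diag_mx D ->
  D \in unitmx ->
  J - alpha *: L \in unitmx ->
  k != 0 ->
  beta != - alpha^* ->
  (spectral_subspace C_kab k :=: colrange L)%MS /\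
  (spectral_subspace D_kab k :=: colrange (invmx (J - alpha *: L) *m L))%MS.
Proof.
move=> J L C_kab D_kab _ uJ4 _ uD uK k0 betaN.
set S := invmx (J - alpha *: L).
have uS : S \in unitmx by rewrite unitmx_inv.
pose c := k * (alpha + beta^*).
(* conjugating turns alpha + beta^* into alpha^* + beta *)
have c0 : c != 0.
  rewrite mulf_neq0 // -(inj_eq (inv_inj conjCK)) rmorphD /= conjCK rmorph0.
  by rewrite addrC addr_eq0.
have JE : J + beta^* *: L = (J - alpha *: L) + (alpha + beta^*) *: L.
  by rewrite scalerDl addrA subrK.
have CE : C_kab - k%:M = c *: (L *m S).
  rewrite /C_kab JE mulmxDl mulmxV // scalerDr scalemx1 -scalemxAl scalerA.
  by rewrite addrAC subrr add0r.
have DE : D_kab - k%:M = c *: (S *m L).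
  rewrite /D_kab JE mulmxDr mulVmx // scalerDr scalemx1 -scalemxAr scalerA.
  by rewrite addrAC subrr add0r.
have Zeq0 p q (X : 'M[R[i]]_(p, q)) : c *: X = 0 -> X = 0.
  by move/eqP; rewrite scaler_eq0 (negPf c0) => /eqP.
have LSL_eq0 p (y : 'M_(_, p)) : L *m (S *m (L *m y)) = 0 -> L *m y = 0.
  exact: mul_LSL_eq0.
split.
- apply: (eqmx_trans (spectral_subspace_semisimple _ _ _ _ _)); rewrite CE.
    move=> w; rewrite -!scalemxAl -!scalemxAr -!mulmxA => /Zeq0/Zeq0.
    by move=> /LSL_eq0->; rewrite scaler0.
  rewrite /colrange linearZ /= trmx_mul.
  apply: eqmx_trans (eqmx_scale _ c0) _.
  by apply: eqmxMfull; rewrite row_full_unit unitmx_tr.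
- apply: (eqmx_trans (spectral_subspace_semisimple _ _ _ _ _)); rewrite DE.
    move=> w; rewrite -!scalemxAl -!scalemxAr -!mulmxA => /Zeq0/Zeq0.
    move=> /(congr1 (mulmx (J - alpha *: L))); rewrite mulKVmx // mulmx0.
    by move=> /LSL_eq0->; rewrite mulmx0 scaler0.
  by rewrite /colrange linearZ /=; apply: eqmx_scale.
Qed.
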